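(* Let $\mathcal{X}$ be a normed linear space (real or complex). Then the modified Davis-Wielandt radius $dw^*(\cdot)$ defines a norm on $\mathcal{L}(\mathcal{X})$. It is equivalent to the usual operator norm $\|\cdot\|$ and satisfies $$\|T\|\leq dw^*(T)\leq \sqrt{2}\,\|T\|\quad\text{for every } T\in\mathcal{L}(\mathcal{X}).$$
   Context: $\mathcal{L}(\mathcal{X})$ is the space of bounded linear operators on $\mathcal{X}$ with the operator norm; $\mathcal{X}^*$ is the dual; $S_{\mathcal{X}}=\{x\in\mathcal{X}:\|x\|=1\}$. For $x\in S_{\mathcal{X}}$ put $\mathcal{J}(x)=\{f\in\mathcal{X}^*: f(x)=1=\|f\|\}$, and $\Pi=\{(x,f): x\in S_{\mathcal{X}}, f\in\mathcal{J}(x)\}$. The modified Davis-Wielandt radius of $T\in\mathcal{L}(\mathcal{X})$ is $dw^*(T)=\sup\left\{\sqrt{|x^*(Tx)|^2+\|Tx\|^2}:(x,x^* )\in\Pi\right\}$. *)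

(* Defs.v *)
From HB Require Import structures.
From mathcomp Require Import all_boot all_order all_algebra.
From mathcomp Require Import boolp classical_sets functions reals.
From mathcomp Require Import topology normedtype.
From mathcomp Require Import complex.
Set Implicit Arguments.
Unset Strict Implicit.
Unset Printing Implicit Defensive.
Import Order.TTheory GRing.Theory Num.Theory.
Import numFieldNormedType.Exports.
Local Open Scope classical_set_scope.
Local Open Scope ring_scope.

Section BoundedOperators.
Variables (K : numFieldType) (X Y : normedModType K).

Definition bounded_linear : {pred X -> Y} :=
  mem [set T : X -> Y | linear T /\ exists M : K, forall x, `|T x| <= M * `|x|].

Lemma bounded_linearP (T : X -> Y) :
  reflect (linear T /\ exists M : K, forall x, `|T x| <= M * `|x|)
          (T \in bounded_linear).
Proof. by apply: (iffP idP); rewrite inE. Qed.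

Lemma bounded_linear_submod_closed : submod_closed bounded_linear.
Proof.
split=> [|a S T /bounded_linearP[linS [M leM]] /bounded_linearP[linT [N leN]]].
  apply/bounded_linearP; split=> [b x y|]; first by rewrite scaler0 addr0.
  by exists 0 => x; rewrite mul0r normr0.
apply/bounded_linearP; split=> [b x y|].
  by rewrite !fctE linS linT !scalerDr !scalerA mulrC addrACA.
exists (`|a| * M + N) => x; rewrite !fctE (le_trans (ler_normD _ _))//.
by rewrite normrZ mulrDl lerD// -mulrA ler_wpM2l.
Qed.

HB.instance Definition _ :=
  GRing.isSubmodClosed.Build K (X -> Y) bounded_linear
    bounded_linear_submod_closed.

Record blop := BLOp {
  blop_fun :> X -> Y;
  blop_bounded_linear : blop_fun \in bounded_linear }.

HB.instance Definition _ := [isSub for blop_fun].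
HB.instance Definition _ := [Choice of blop by <:].
HB.instance Definition _ := [SubChoice_isSubLmodule of blop by <:].

End BoundedOperators.

Notation "''L' ( X , Y )" := (blop X Y)
  (at level 8, X at level 2, Y at level 2, format "''L' ( X ,  Y )") : type_scope.
Notation "''L' ( X )" := (blop X X)
  (at level 8, X at level 2, format "''L' ( X )") : type_scope.

(* MathComp norms take values in the scalar field, whereas suprema are only
   available over R: [rnorm] is the norm read as an element of R. *)
Variant scalars := RealScalars | ComplexScalars.

Definition scalar_field (R : realType) (s : scalars) : numFieldType :=
  match s with RealScalars => R | ComplexScalars => R[i] end.

Definition realpart (R : realType) (s : scalars) : scalar_field R s -> R :=
  match s with RealScalars => id | ComplexScalars => @complex.Re R end.

Definition rnorm (R : realType) (s : scalars)
    (V : normedModType (scalar_field R s)) (v : V) : R := realpart `|v|.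

(* For bounded operators, the suprema below are over sets that are bounded
   above; [sup set0 = 0] gives the expected value when X is the zero space. *)
Section DavisWielandt.
Variables (R : realType) (s : scalars).
Local Notation K := (scalar_field R s).
Implicit Types X Y : normedModType K.

Definition opnorm X Y (T : 'L(X, Y)) : R :=
  sup [set rnorm (T x) | x in [set x : X | rnorm x <= 1]].

Definition unit_sphere X : set X := [set x | rnorm x = 1].

Local Notation dual X := 'L(X, K^o).

Definition duality_map X (x : X) : set (dual X) :=
  [set f : dual X | f x = 1 /\ opnorm f = 1].

Definition Pi X : set (X * dual X) :=
  [set p : X * dual X | unit_sphere p.1 /\ duality_map p.1 p.2].

Definition dwstar X (T : 'L(X)) : R :=
  sup [set Num.sqrt (rnorm (p.2 (T p.1) : K^o) ^+ 2 + rnorm (T p.1) ^+ 2)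
      | p in @Pi X].

Record is_norm (V : lmodType K) (N : V -> R) : Prop := IsNorm {
  is_norm_ge0 : forall v, 0 <= N v;
  is_norm_eq0 : forall v, N v = 0 -> v = 0;
  is_normZ : forall (a : K) v, N (a *: v) = rnorm (a : K^o) * N v;
  is_normD : forall v w, N (v + w) <= N v + N w }.

Definition equivalent_norms (V : lmodType K) (N1 N2 : V -> R) : Prop :=
  exists c C : R, [/\ 0 < c, 0 < C &
    forall v, c * N1 v <= N2 v /\ N2 v <= C * N1 v].

End DavisWielandt.

(* Main.v *)
From HB Require Import structures.
Require Import Defs.
From mathcomp Require Import all_boot all_order all_algebra.
From mathcomp Require Import boolp classical_sets functions reals.
From mathcomp Require Import topology normedtype complex.
From mathcomp Require Import ring lra.
Import Order.TTheory GRing.Theory Num.Theory.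
Import numFieldNormedType.Exports.
Local Open Scope ring_scope.

(** The two inequalities carry everything.  For a pair [(x, f)] in [Pi] both
    [|f (T x)|] and [|T x|] are at most [opnorm T], whence the upper bound with
    constant [sqrt 2].  For the lower bound, [|T x|^2] is one of the two terms
    under the root, so [|T x|] is at most [dwstar T] as soon as [x] occurs as the
    first component of some pair of [Pi], that is, as soon as the duality map
    is nonempty at every unit vector ([duality_map_nonempty]); this is the
    Hahn-Banach theorem.  Definiteness of [dwstar] follows from the lower
    bound; homogeneity and the triangle inequality hold pair by pair (the
    latter is the triangle inequality of the Euclidean plane) and pass to the
    supremum.

    Hahn-Banach is proved here by an argument on functionals defined on the
    whole space.  By Zorn's lemma there is a minimal sublinear functional [q]
    below a given one.  For any sublinear [q] and any vector [x], the functional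
    [tilt q x y = inf_(t >= 0) (q (y + t x) - t q x)] is sublinear, is below
    [q], and takes at [- x] a value at most [- q x].  If [q] is minimal then
    [tilt q x] is [q] itself, so [q (- x) <= - q x] for every [x], and a
    sublinear functional with this property is linear.  Tilting the given
    functional [p] along [x] before minimizing forces the linear functional
    obtained to agree with [p] at [x] ([exists_linear_below]).

    Over the complex numbers, [g] being a real-linear functional below the
    norm with [g x = |x|], [f v = g v - i g (i v)] is complex-linear,
    and rotating [v] so that [f v] is a nonnegative real gives
    [|f v| <= |v|]. *)

(** * Sublinear functionals and the Hahn-Banach theorem *)

Section Sublinear.
Context {R : realType} {V : lmodType R}.
Implicit Types (p q : V -> R) (x y : V).

Definition sublinear q : Prop :=
  (forall x y, q (x + y) <= q x + q y) /\
  (forall (a : R) x, 0 <= a -> q (a *: x) = a * q x).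

Lemma sublinear0 q : sublinear q -> q 0 = 0.
Proof. by case=> _ /(_ 0 0 (lexx 0)); rewrite scale0r mul0r. Qed.

(** The upper bound for [a] and for its inverse together give homogeneity. *)
Lemma subadditive_sublinear q : (forall x y, q (x + y) <= q x + q y) ->
  (forall a x, 0 < a -> q (a *: x) <= a * q x) -> sublinear q.
Proof.
move=> qD qM; split=> // a x; rewrite le_eqVlt => /orP[/eqP <-|a0].
  rewrite scale0r mul0r.
  have := qM 2%:R 0 (ltr0Sn _ _); have := qM 2%:R^-1 0.
  by rewrite invr_gt0 ltr0Sn !scaler0 => /(_ isT); lra.
apply/eqP; rewrite eq_le qM//= -ler_pdivlMl//.
have := qM a^-1 (a *: x); rewrite invr_gt0 scalerA mulVf ?gt_eqF// scale1r.
by move=> /(_ a0).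
Qed.

Lemma sublinear_geN q x : sublinear q -> - q (- x) <= q x.
Proof.
move=> sq; have := sq.1 x (- x).
by rewrite subrr sublinear0// -lerBlDr sub0r.
Qed.

Lemma sublinear_odd_linear q :
  sublinear q -> (forall x, q (- x) <= - q x) -> linear (q : V -> R^o).
Proof.
move=> sq oddq; have qN x : q (- x) = - q x.
  by apply/eqP; rewrite eq_le oddq lerNl sublinear_geN.
have qD x y : q (x + y) = q x + q y.
  apply/eqP; rewrite eq_le sq.1 -lerN2 -qN !opprD -!qN; exact: sq.1.
move=> a x y; rewrite qD; congr (_ + _).
have [a0|a0] := leP 0 a; first exact: sq.2.
rewrite -[in LHS](opprK a) scaleNr qN sq.2 ?oppr_ge0 ?ltW//.
by rewrite mulNr opprK.
Qed.

Local Open Scope classical_set_scope.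

(** The largest sublinear functional [r <= q] with [r (- x) <= - q x]; the
    parameter [t] allows any amount of [x] to be moved at the linear price
    [q x]. *)
Definition tilt q x y : R :=
  inf [set q (y + t *: x) - t * q x | t in [set t | 0 <= t]].

Lemma tilt_le q x y t :
  sublinear q -> 0 <= t -> tilt q x y <= q (y + t *: x) - t * q x.
Proof.
move=> sq t0; apply: ge_inf; last by exists t.
exists (- q (- y)) => _ [u /= u0 <-].
rewrite -sq.2// lerBrDr addrC lerBlDr.
by have := sq.1 (y + u *: x) (- y); rewrite addrAC subrr add0r.
Qed.

Lemma tilt_ge q x y m :
  (forall t, 0 <= t -> m <= q (y + t *: x) - t * q x) -> m <= tilt q x y.
Proof.
move=> lem; apply: lb_le_inf; first by exists (q (y + 0 *: x) - 0 * q x), 0 => /=.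
by move=> _ [t /= t0 <-]; exact: lem.
Qed.

Lemma tilt_le_self q x y : sublinear q -> tilt q x y <= q y.
Proof.
by move=> sq; have := tilt_le q x y 0 sq (lexx 0); rewrite scale0r mul0r addr0 subr0.
Qed.

Lemma tiltN q x : sublinear q -> tilt q x (- x) <= - q x.
Proof.
move=> sq; have := tilt_le q x (- x) 1 sq ler01.
by rewrite scale1r addNr sublinear0// mul1r sub0r.
Qed.

Lemma tilt_sublinear q x : sublinear q -> sublinear (tilt q x).
Proof.
move=> sq; apply: subadditive_sublinear => [y z|a y a0].
  rewrite -lerBlDl; apply: tilt_ge => t t0; rewrite lerBlDl -lerBlDr.
  apply: tilt_ge => u u0; rewrite lerBlDr.
  apply: le_trans (tilt_le q x (y + z) (u + t) sq (addr_ge0 u0 t0)) _.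
  have := sq.1 (y + u *: x) (z + t *: x).
  rewrite addrACA -scalerDl; lra.
rewrite -ler_pdivrMl//; apply: tilt_ge => t t0; rewrite ler_pdivrMl//.
apply: le_trans (tilt_le q x (a *: y) (a * t) sq (mulr_ge0 (ltW a0) t0)) _.
by rewrite -scalerA -scalerDr sq.2 ?(ltW a0)//; lra.
Qed.

(** Zorn's lemma for the reverse pointwise order: the pointwise infimum of a
    nonempty chain is finite because every sublinear [q <= p] satisfies
    [q y >= - p (- y)], and subadditive because, of two members of the chain,
    the smaller one can be used at both arguments. *)
Lemma exists_minimal_sublinear p : sublinear p ->
  exists q, [/\ sublinear q, (forall y, q y <= p y) &
    forall r, sublinear r -> (forall y, r y <= q y) -> forall y, q y <= r y].
Proof.
move=> sp; pose D := {q : V -> R | sublinear q /\ forall y, q y <= p y}.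
pose ge (r s : D) := `[< forall y, sval s y <= sval r y >].
have p0 : D by exists p.
have lbD (s : D) y : - p (- y) <= sval s y.
  have [sq sp'] := svalP s.
  by apply: le_trans (sublinear_geN _ y sq); rewrite lerN2.
have [| | |[q [sq leqp]] minq] := @ZL_preorder D p0 ge.
- by move=> s; apply/asboolP.
- move=> r s t /asboolP rs /asboolP st; apply/asboolP => y.
  exact: le_trans (st y) (rs y).
- move=> A totA; have [->|/set0P[s0 As0]] := eqVneq A set0; first by exists p0 => s [].
  have lb_A y : has_lbound [set sval s y | s in A].
    by exists (- p (- y)) => _ [s _ <-].
  pose m y := inf [set sval s y | s in A].
  have m_le s y : A s -> m y <= sval s y.
    by move=> As; apply: ge_inf => //; exists s.
  have le_m y c : (forall s, A s -> c <= sval s y) -> c <= m y.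
    move=> lec; apply: lb_le_inf; first by exists (sval s0 y), s0.
    by move=> _ [s As <-]; exact: lec.
  have sm : sublinear m.
    apply: subadditive_sublinear => [x y|a y a0].
      rewrite -lerBlDl; apply: (le_m) => s As; rewrite lerBlDl -lerBlDr.
      apply: (le_m) => t At; rewrite lerBlDr.
      have [/asboolP st|/asboolP ts] := totA s t As At.
        apply: le_trans (m_le t _ At) _.
        by apply: le_trans ((svalP t).1.1 x y) _; rewrite lerD2l.
      apply: le_trans (m_le s _ As) _.
      by apply: le_trans ((svalP s).1.1 x y) _; rewrite lerD2r.
    rewrite -ler_pdivrMl//; apply: (le_m) => s As; rewrite ler_pdivrMl//.
    by rewrite -(svalP s).1.2 ?(ltW a0)//; exact: m_le.
  have mp y : m y <= p y.
    by apply: le_trans (m_le s0 y As0) _; exact: (svalP s0).2.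
  by exists (exist _ m (conj sm mp)) => s As; apply/asboolP => y; exact: m_le.
- exists q; split=> // r sr leqr.
  have lerp y : r y <= p y := le_trans (leqr y) (leqp y).
  exact/asboolP/(minq (exist _ r (conj sr lerp)))/asboolP.
Qed.

(** The Hahn-Banach theorem in dominated form.  A functional below
    [tilt p x] satisfies [g (- x) <= - p x], hence [g x >= p x] once [g] is
    known to be odd. *)
Lemma exists_linear_below p x : sublinear p ->
  exists2 g : {linear V -> R^o}, forall y, g y <= p y & g x = p x.
Proof.
move=> sp; have stp := tilt_sublinear p x sp.
have [g [sg legp ming]] := exists_minimal_sublinear _ stp.
have gN y : g (- y) <= - g y.
  apply: le_trans (tiltN g y sg); apply: ming; first exact: tilt_sublinear.
  by move=> z; exact: tilt_le_self.
have gp y : g y <= p y := le_trans (legp y) (tilt_le_self _ _ _ sp).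
pose gL : {linear V -> R^o} :=
  HB.pack g (GRing.isLinear.Build R V R^o _ g (sublinear_odd_linear g sg gN)).
exists gL => //=; apply/eqP; rewrite eq_le gp /= -lerN2.
by apply: le_trans (tiltN p x sp); apply: le_trans (legp (- x));
  rewrite lerNl sublinear_geN.
Qed.

End Sublinear.

(** * Norm-attaining functionals over the real and the complex numbers *)

Section RealRestriction.
Context {R : realType}.

(** An alias, so that the real module structure does not compete with the
    complex one on [V]. *)
Definition restrict_scalars (V : lmodType R[i]) : Type := V.

HB.instance Definition _ (V : lmodType R[i]) :=
  GRing.Zmodule.on (restrict_scalars V).

Section Instance.
Variable V : lmodType R[i].
Local Notation W := (restrict_scalars V).

Let rscale (a : R) (v : W) : W := (a%:C)%C *: (v : V).

Let rscaleA a b v : rscale a (rscale b v) = rscale (a * b) v.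
Proof. by rewrite /rscale scalerA rmorphM. Qed.

Let rscale1 : left_id 1 rscale.
Proof. by move=> v; rewrite /rscale rmorph1 scale1r. Qed.

Let rscaleDr : right_distributive rscale +%R.
Proof. by move=> a u v; rewrite /rscale scalerDr. Qed.

Let rscaleDl v : {morph rscale^~ v : a b / a + b}.
Proof. by move=> a b; rewrite /rscale rmorphD scalerDl. Qed.

HB.instance Definition _ :=
  GRing.Zmodule_isLmodule.Build R W rscaleA rscale1 rscaleDr rscaleDl.

Lemma restrict_scalarsE (a : R) (v : V) : a *: (v : W) = (a%:C)%C *: v.
Proof. by []. Qed.

End Instance.

Lemma norm_attaining_functional_real (X : normedModType R) (x : X) :
  exists f : X -> R^o,
    [/\ linear f, (forall y, `|f y| <= `|y|) & f x = `|x|].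
Proof.
have sn : sublinear (fun y : X => `|y|).
  split=> [y z|a y a0]; first exact: ler_normD.
  by rewrite normrZ ger0_norm.
have [f lef fx] := exists_linear_below _ x sn.
exists f; split=> [|y|//].
  by move=> a u v; rewrite linearP.
by rewrite ler_norml lef andbT lerNl -raddfN -(normrN y) lef.
Qed.

(** A complex-linear functional is determined by its real part [g]: its
    imaginary part at [v] is minus its real part at [i v]. *)
Lemma complex_of_real_linear (V : lmodType R[i])
    (g : {linear restrict_scalars V -> R^o}) :
  linear ((fun v => (g v -i* g ('i *: v))%C) : V -> R[i]^o).
Proof.
have gZ (a : R) (v : V) : g ((a%:C)%C *: v) = a * g v.
  by rewrite -restrict_scalarsE linearZ.
have gD (u v : V) : g (u + v) = g u + g v by exact: raddfD.
have gN (v : V) : g (- v) = - g v by exact: raddfN.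
have scalei (a : R) (v : V) : 'i%C *: ((a%:C)%C *: v) = (a%:C)%C *: ('i%C *: v).
  by rewrite !scalerA mulrC.
have scaleii (v : V) : 'i%C *: ('i%C *: v) = - v.
  by rewrite scalerA -expr2 sqr_i scaleN1r.
move=> [a b] u v; rewrite (complexE (a +i* b)%C) /= !scalerDl -!scalerA.
rewrite !(scalerDr, scalei, scaleii, gD, gZ, gN).
apply/eqP; rewrite eq_complex /=; apply/andP; split; apply/eqP; ring.
Qed.

Lemma Re_norm (X : normedModType R[i]) (y : X) :
  ((complex.Re `|y|)%:C)%C = `|y|.
Proof. by rewrite RRe_real// normr_real. Qed.

Lemma norm_attaining_functional_complex (X : normedModType R[i]) (x : X) :
  exists f : X -> R[i]^o,
    [/\ linear f, (forall y, `|f y| <= `|y|) & f x = `|x|].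
Proof.
have sn : sublinear ((fun y => complex.Re `|y : X|) : restrict_scalars X -> R).
  split=> [y z|a y a0].
    by rewrite -lecR rmorphD/= !Re_norm ler_normD.
  rewrite restrict_scalarsE normrZ ger0_norm ?lecR//.
  by rewrite -Re_norm -rmorphM.
have [g leg gx] := @exists_linear_below R (restrict_scalars X) _ x sn.
pose f (v : X) : R[i]^o := (g v -i* g ('i *: v))%C.
have linf : linear f by exact: complex_of_real_linear.
have fZ c v : f (c *: v) = c * f v.
  by rewrite -[c *: v]addr0 linf [f 0](_ : _ = 0) ?addr0// /f scaler0 raddf0 oppr0.
have fle y : `|f y| <= `|y|.
  have [->|fy0] := eqVneq (f y) 0; first by rewrite normr0.
  (* [c] is the rotation that makes [f (c *: y)] a nonnegative real, where [f]
     and its real part [g] agree. *)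
  pose c : R[i] := `|f y| / f y.
  have c1 : `|c| = 1 by rewrite normrM normfV normr_id divff// normr_eq0.
  have fcy : f (c *: y) = `|f y| by rewrite fZ divfK.
  rewrite -[`|y|]mul1r -c1 -normrZ -(Re_norm _ (c *: y)).
  by rewrite -[`|f y|](Re_norm R[i]^o) -fcy lecR; exact: leg.
exists f; split=> //.
(* The real part of [f x] already has the maximal modulus [|x|]. *)
have Imfx : complex.Im (f x) = 0.
  have := fle x; rewrite -ler_sqr ?nnegrE ?normr_ge0//.
  rewrite -(add_Re2_Im2 (f x)) -[in leRHS]Re_norm -rmorphXn lecR /= -gx.
  rewrite gerDl sqrrN => Im0.
  by apply/eqP; rewrite oppr_eq0 -sqrf_eq0 eq_le Im0 sqr_ge0.
by apply/eqP; rewrite eq_complex Imfx -Re_norm /= gx !eqxx.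
Qed.

End RealRestriction.

(** * Real-valued norms and the operator norm *)

Section ScalarNorm.
Context {R : realType} {s : scalars}.
Local Notation K := (scalar_field R s).
Implicit Types X : normedModType K.

Lemma realpart_le (a b : K) : a <= b -> realpart a <= realpart b.
Proof.
by case: s a b => //= a b; rewrite lecE => /andP[].
Qed.

Lemma rnorm_ge0 {X} (x : X) : 0 <= rnorm x.
Proof.
rewrite /rnorm; have := normr_ge0 x; move: (`|x|) => a.
by case: s a => //= a; rewrite lecE => /andP[].
Qed.

Lemma rnormZ {X} (a : K) (x : X) : rnorm (a *: x) = rnorm (a : K^o) * rnorm x.
Proof.
rewrite /rnorm normrZ; have := normr_ge0 a; have := normr_ge0 x.
have -> : `|a : K^o| = `|a| by [].
move: (`|a|) (`|x|) => b c.
case: s b c => //= b c; rewrite !lecE /= => /andP[/eqP c0 _] /andP[/eqP b0 _].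
by case: b c b0 c0 => [b b'] [c c'] /= -> ->; rewrite mulr0 subr0.
Qed.

Lemma rnormD {X} (x y : X) : rnorm (x + y) <= rnorm x + rnorm y.
Proof.
apply: le_trans (realpart_le _ _ (ler_normD x y)) _.
by rewrite /rnorm; move: (`|x|) (`|y|); case: s => //= -[a a'] [b b'].
Qed.

Lemma rnorm0 {X} : rnorm (0 : X) = 0.
Proof. by rewrite /rnorm normr0; case: s. Qed.

Lemma rnorm_eq0 {X} (x : X) : rnorm x = 0 -> x = 0.
Proof.
move=> x0; apply/eqP; rewrite -normr_eq0; move: x0.
rewrite /rnorm; have := normr_ge0 x; move: (`|x|) => a.
case: s a => /= [a _ ->//|[a b]]; rewrite lecE/= => /andP[/eqP-> _] ->.
by rewrite eqxx.
Qed.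

Lemma rnorm1 : rnorm (1 : K^o) = 1.
Proof. by rewrite /rnorm normr1; case: s. Qed.

Lemma rnormV (a : K) : rnorm (a^-1 : K^o) = (rnorm (a : K^o))^-1.
Proof.
have [->|a0] := eqVneq a 0; first by rewrite invr0 rnorm0 invr0.
have na0 : rnorm (a : K^o) != 0.
  by apply: contra_neq a0; exact: (@rnorm_eq0 K^o).
apply: (mulIf na0); rewrite mulVf// -(@rnormZ K^o).
by rewrite /GRing.scale/= mulVf// rnorm1.
Qed.

Lemma exists_unit_multiple {X} (x : X) : x != 0 ->
  exists2 u : X, rnorm u = 1 & exists a : K, x = a *: u.
Proof.
move=> x0; have nx0 : `|x| != 0 by rewrite normr_eq0.
have rn : rnorm (`|x| : K^o) = rnorm x by rewrite /rnorm normr_id.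
exists (`|x|^-1 *: x); last by exists `|x|; rewrite scalerA divff// scale1r.
rewrite rnormZ rnormV rn mulVf//; apply: contra_neq x0; exact: rnorm_eq0.
Qed.

End ScalarNorm.

Section OperatorNorm.
Context {R : realType} {s : scalars}.
Local Notation K := (scalar_field R s).
Implicit Types X Y : normedModType K.
Local Open Scope classical_set_scope.

Lemma blop_linear {X Y} (T : 'L(X, Y)) : linear T.
Proof. by case/bounded_linearP: (blop_bounded_linear T). Qed.

Lemma blop0 {X Y} (T : 'L(X, Y)) : T 0 = 0.
Proof.
have := blop_linear T 1 0 0; rewrite scaler0 addr0 scale1r => /eqP.
by rewrite -subr_eq0 opprD addNKr oppr_eq0 => /eqP.
Qed.

Lemma blopZ {X Y} (T : 'L(X, Y)) a x : T (a *: x) = a *: T x.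
Proof. by rewrite -[a *: x]addr0 blop_linear blop0 addr0. Qed.

(** The bound supplied by boundedness is a scalar of [K], of unspecified sign;
    its norm serves as a nonnegative real bound. *)
Lemma blop_bounded {X Y} (T : 'L(X, Y)) :
  exists2 M : R, 0 <= M & forall x, rnorm (T x) <= M * rnorm x.
Proof.
case/bounded_linearP: (blop_bounded_linear T) => _ [M leM].
exists (rnorm (M : K^o)); first exact: rnorm_ge0.
move=> x; rewrite -rnormZ /rnorm; apply: realpart_le.
rewrite normrZ (le_trans (leM x))// -[in leRHS](normr_id x) -normrM.
by rewrite ger0_norm//; apply: le_trans (leM x).
Qed.

Lemma opnorm_ub {X Y} (T : 'L(X, Y)) x : rnorm x <= 1 -> rnorm (T x) <= opnorm T.
Proof.
move=> x1; apply: ub_le_sup; last by exists x.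
have [M M0 leM] := blop_bounded T; exists M => _ [y /= y1 <-].
by rewrite (le_trans (leM y))// ler_piMr.
Qed.

Lemma opnorm_le {X Y} (T : 'L(X, Y)) M :
  (forall x, rnorm x <= 1 -> rnorm (T x) <= M) -> opnorm T <= M.
Proof.
move=> leM; apply: ge_sup; first by exists (rnorm (T 0)), 0 => //=; rewrite rnorm0.
by move=> _ [y /= y1 <-]; exact: leM.
Qed.

Lemma opnorm_ge0 {X Y} (T : 'L(X, Y)) : 0 <= opnorm T.
Proof. by rewrite (le_trans (rnorm_ge0 (T 0)))// opnorm_ub// rnorm0. Qed.

Lemma rnorm_le_opnorm {X Y} (T : 'L(X, Y)) x : rnorm (T x) <= opnorm T * rnorm x.
Proof.
have [->|/exists_unit_multiple[u u1 [a ->]]] := eqVneq x 0.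
  by rewrite blop0 !rnorm0 mulr0.
by rewrite blopZ !rnormZ u1 mulr1 mulrC ler_wpM2r ?rnorm_ge0 ?opnorm_ub ?u1.
Qed.

Lemma duality_map_nonempty {X} (x : X) : rnorm x = 1 ->
  exists f : 'L(X, K^o), duality_map x f.
Proof.
move=> x1.
have [f [linf fle fx]] : exists f : X -> K^o,
    [/\ linear f, (forall y, `|f y| <= `|y|) & f x = `|x|].
  case: s X x x1 => X x _; [exact: norm_attaining_functional_real|].
  exact: norm_attaining_functional_complex.
have bf : f \in @bounded_linear K X K^o.
  by apply/bounded_linearP; split=> //; exists 1 => y; rewrite mul1r.
exists (BLOp bf); have fx1 : f x = 1.
  rewrite fx; move: x1; rewrite /rnorm; have := normr_ge0 x.
  move: (`|x|) => a; case: s a => //= -[a b]; rewrite lecE/= => /andP[/eqP-> _].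
  by move=> ->.
split=> //; apply/eqP; rewrite eq_le opnorm_le ?(le_trans _ (opnorm_ub _ x _)) ?x1//=.
  by rewrite fx1 rnorm1.
by move=> y y1; rewrite (le_trans _ y1)// realpart_le.
Qed.

End OperatorNorm.

(** * The modified Davis-Wielandt radius *)

Section DavisWielandtNorm.
Context {R : realType} {s : scalars} {X : normedModType (scalar_field R s)}.
Local Notation K := (scalar_field R s).
Implicit Types (S T : 'L(X)) (p : X * 'L(X, K^o)).
Local Open Scope classical_set_scope.

Definition dw_value T p : R :=
  Num.sqrt (rnorm (p.2 (T p.1) : K^o) ^+ 2 + rnorm (T p.1) ^+ 2).

Lemma dw_value_le T p : Pi p -> dw_value T p <= Num.sqrt 2 * opnorm T.
Proof.
case: p => x f [/= x1 [_ f1]].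
have Tx : rnorm (T x) <= opnorm T by rewrite opnorm_ub// x1.
have fTx : rnorm (f (T x) : K^o) <= opnorm T.
  by rewrite (le_trans (rnorm_le_opnorm _ _))// f1 mul1r.
rewrite -[X in _ * X]ger0_norm ?opnorm_ge0// -sqrtr_sqr -sqrtrM// ler_wsqrtr//=.
by rewrite mulr_natl mulr2n lerD// ler_sqr ?nnegrE ?rnorm_ge0 ?opnorm_ge0.
Qed.

Lemma dw_valueZ a T p : dw_value (a *: T) p = rnorm (a : K^o) * dw_value T p.
Proof.
rewrite /dw_value.
have -> : (a *: T) p.1 = a *: T p.1 by [].
rewrite blopZ !rnormZ !exprMn -mulrDr sqrtrM ?sqr_ge0//.
by rewrite sqrtr_sqr ger0_norm ?rnorm_ge0.
Qed.

(** The triangle inequality of the Euclidean plane, read as that of the complex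
    modulus. *)
Lemma dw_valueD S T p : dw_value (S + T) p <= dw_value S p + dw_value T p.
Proof.
rewrite /dw_value; have -> : (S + T) p.1 = S p.1 + T p.1 by [].
have := le_normcD
  (rnorm (p.2 (S p.1) : K^o) +i* rnorm (S p.1))%C
  (rnorm (p.2 (T p.1) : K^o) +i* rnorm (T p.1))%C.
apply: le_trans; rewrite /= ler_wsqrtr// lerD// ler_sqr ?nnegrE
  ?addr_ge0 ?rnorm_ge0 ?rnormD//.
have -> : p.2 (S p.1 + T p.1) = p.2 (S p.1) + p.2 (T p.1).
  by have := blop_linear p.2 1 (S p.1) (T p.1); rewrite !scale1r.
exact: rnormD.
Qed.

Lemma dw_value_le_dwstar T p : Pi p -> dw_value T p <= dwstar T.
Proof.
move=> Pip; apply: ub_le_sup; last by exists p.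
by exists (Num.sqrt 2 * opnorm T) => _ [q Piq <-]; exact: dw_value_le.
Qed.

(** The bound is required to be nonnegative because [Pi] is empty when [X] is
    the zero space; the radius is then [sup set0 = 0]. *)
Lemma dwstar_le T M :
  0 <= M -> (forall p, Pi p -> dw_value T p <= M) -> dwstar T <= M.
Proof.
move=> M0 leM; rewrite /dwstar; have [->|/set0P Pi0] := eqVneq (@Pi R s X) set0.
  by rewrite image_set0 sup0.
apply: ge_sup; first exact: image_nonempty.
by move=> _ [p Pip <-]; exact: leM.
Qed.

Lemma dwstar_ge0 T : 0 <= dwstar T.
Proof.
have [Pi0|/set0P[p Pip]] := eqVneq (@Pi R s X) set0.
  by rewrite /dwstar Pi0 image_set0 sup0.
by apply: le_trans (dw_value_le_dwstar T p Pip); exact: sqrtr_ge0.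
Qed.

Lemma opnorm_le_dwstar T : opnorm T <= dwstar T.
Proof.
apply: opnorm_le => x; have [->|/exists_unit_multiple[u u1 [a ->]]] := eqVneq x 0.
  by rewrite blop0 rnorm0 dwstar_ge0.
rewrite blopZ !rnormZ u1 mulr1 => a1.
apply: le_trans (ler_piMl (rnorm_ge0 _) a1) _.
have [f Jf] := duality_map_nonempty u u1.
apply: le_trans (dw_value_le_dwstar T (u, f) (conj u1 Jf)).
rewrite -[leLHS]ger0_norm ?rnorm_ge0// -sqrtr_sqr ler_wsqrtr//=.
by rewrite lerDr sqr_ge0.
Qed.

Lemma dwstar_le_opnorm T : dwstar T <= Num.sqrt 2 * opnorm T.
Proof.
apply: dwstar_le => [|p]; last exact: dw_value_le.
by rewrite mulr_ge0 ?sqrtr_ge0 ?opnorm_ge0.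
Qed.

Lemma dwstarZ_le a T : dwstar (a *: T) <= rnorm (a : K^o) * dwstar T.
Proof.
apply: dwstar_le => [|p Pip]; first by rewrite mulr_ge0 ?rnorm_ge0 ?dwstar_ge0.
by rewrite dw_valueZ ler_wpM2l ?rnorm_ge0 ?dw_value_le_dwstar.
Qed.

(** The reverse of [dwstarZ_le] for [a] is [dwstarZ_le] for the inverse of
    [a]. *)
Lemma dwstarZ a T : dwstar (a *: T) = rnorm (a : K^o) * dwstar T.
Proof.
apply/eqP; rewrite eq_le dwstarZ_le /=.
have [->|a0] := eqVneq a 0; first by rewrite rnorm0 mul0r dwstar_ge0.
have ra0 : 0 < rnorm (a : K^o).
  rewrite lt_neqAle rnorm_ge0 andbT eq_sym; apply: contra_neq a0.
  exact: (@rnorm_eq0 _ _ K^o).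
by rewrite -ler_pdivlMl// -rnormV -[in leLHS](scalerK a0 T) dwstarZ_le.
Qed.

Lemma dwstarD S T : dwstar (S + T) <= dwstar S + dwstar T.
Proof.
apply: dwstar_le => [|p Pip]; first by rewrite addr_ge0 ?dwstar_ge0.
by apply: le_trans (dw_valueD S T p) _; rewrite lerD ?dw_value_le_dwstar.
Qed.

Lemma dwstar_eq0 T : dwstar T = 0 -> T = 0.
Proof.
move=> T0; apply/val_inj/funext => x; apply: rnorm_eq0.
apply/eqP; rewrite eq_le rnorm_ge0 andbT.
apply: le_trans (rnorm_le_opnorm T x) _.
apply: le_trans (ler_wpM2r (rnorm_ge0 x) (opnorm_le_dwstar T)) _.
by rewrite T0 mul0r.
Qed.

Lemma dwstar_is_norm : is_norm (fun T : 'L(X) => dwstar T).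
Proof.
by split; [exact: dwstar_ge0|exact: dwstar_eq0|exact: dwstarZ|exact: dwstarD].
Qed.

End DavisWielandtNorm.

Theorem theorem2p7 (R : realType) (s : scalars)
    (X : normedModType (scalar_field R s)) :
  [/\ is_norm (fun T : 'L(X) => dwstar T),
      equivalent_norms (fun T : 'L(X) => opnorm T) (fun T : 'L(X) => dwstar T)
    & forall T : 'L(X),
        opnorm T <= dwstar T /\ dwstar T <= Num.sqrt 2 * opnorm T].
Proof.
have bounds (T : 'L(X)) : opnorm T <= dwstar T /\ dwstar T <= Num.sqrt 2 * opnorm T.
  by split; [exact: opnorm_le_dwstar | exact: dwstar_le_opnorm].
split=> //; first exact: dwstar_is_norm.
by exists 1, (Num.sqrt 2); split=> [||T]; rewrite ?sqrtr_gt0 ?mul1r ?ltr0Sn.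
Qed.
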